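(* Let $\lambda_1\in\mathbb{R}$ with $0<|\lambda_1|<1$ and $h\in\mathbb{R}_{>0}$. Consider the instance of the priori (resp., posteriori) KFSA problem with $W=I_3$, $V=\mathbf{0}_{4\times 4}$, $$A=\begin{bmatrix}\lambda_1&0&0\\0&0&0\\0&0&0\end{bmatrix},\qquad C=\begin{bmatrix}1&h&h\\1&0&h\\0&1&0\\0&0&1\end{bmatrix},$$ installed sensors $\mathcal{Q}=\{1,2,3,4\}$ where sensor $i$ corresponds to the $i$th row of $C$, attack costs $\omega=[1\ 1\ 1\ 1]^T$ and attack budget $\Omega=2$. Let $\tilde\Sigma_{gre}$ (resp., $\tilde\Sigma^*_{gre}$) be the steady state a priori (resp., a posteriori) error covariance for the sensors surviving the attack produced by the greedy algorithm for the priori (resp., posteriori) problem, and let $\tilde\Sigma_{opt}$ (resp., $\tilde\Sigma^*_{opt}$) be that for an optimal attack. Then the ratios $r_{gre}(\tilde\Sigma)=\frac{\mathrm{trace}(\tilde\Sigma_{opt})}{\mathrm{trace}(\tilde\Sigma_{gre})}$ and $r_{gre}(\tilde\Sigma^* )=\frac{\mathrm{trace}(\tilde\Sigma^*_{opt})}{\mathrm{trace}(\tilde\Sigma^*_{gre})}$ satisfy $$\lim_{h\to 0}r_{gre}(\tilde\Sigma)=\frac23+\frac{1}{3(1-\lambda_1^2)}\qquad\text{and}\qquad \lim_{h\to 0}r_{gre}(\tilde\Sigma^* )=\frac{1}{1-\lambda_1^2},$$ respectively.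
   Context: System model. Consider $x[k+1]=Ax[k]+w[k]$, $x[k]\in\mathbb{R}^n$, with $w[k]$ zero-mean white Gaussian noise of covariance $W$, and sensors $i\in\mathcal{Q}=\{1,\dots,q\}$ with scalar measurements $y_i[k]=C_ix[k]+v_i[k]$, where $C_i$ is the $i$th row of $C$ and the stacked noise $v[k]$ is zero-mean white Gaussian with covariance $V$, uncorrelated with $w$. The initial state is Gaussian, independent of the noises, with mean $\mathbf{0}$ and covariance $\Pi_0=I_n$. For a set $\mathcal{T}\subseteq\mathcal{Q}$ of sensors in use, $C(\mathcal{T})$ and $V(\mathcal{T})$ are the stacked measurement matrix and noise covariance of the sensors in $\mathcal{T}$. The Kalman filter error covariances are given by $\Sigma_{0|-1}=\Pi_0$, $\Sigma_{k|k}=\Sigma_{k|k-1}-\Sigma_{k|k-1}C(\mathcal{T})^T(C(\mathcal{T})\Sigma_{k|k-1}C(\mathcal{T})^T+V(\mathcal{T}))^{-1}C(\mathcal{T})\Sigma_{k|k-1}$, $\Sigma_{k+1|k}=A\Sigma_{k|k}A^T+W$ (pseudo-inverse if singular). The steady state a priori and a posteriori error covariances are $\Sigma(\mathcal{T})=\lim_k\Sigma_{k|k-1}$ and $\Sigma^*(\mathcal{T})=\lim_k\Sigma_{k|k}$; they satisfy $\Sigma(\mathcal{T})=A\Sigma^*(\mathcal{T})A^T+W$ and $\Sigma^*(\mathcal{T})=\Sigma(\mathcal{T})-\Sigma(\mathcal{T})C(\mathcal{T})^T(C(\mathcal{T})\Sigma(\mathcal{T})C(\mathcal{T})^T+V(\mathcal{T}))^{-1}C(\mathcal{T})\Sigma(\mathcal{T})$.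 With unit attack costs and integer budget $\Omega$, the priori (resp., posteriori) KFSA problem is to choose a set $\mathcal{S}\subseteq\mathcal{Q}$, $|\mathcal{S}|\le\Omega$, of sensors to attack (remove) so as to maximize $\mathrm{trace}(\Sigma(\mathcal{Q}\setminus\mathcal{S}))$ (resp., $\mathrm{trace}(\Sigma^*(\mathcal{Q}\setminus\mathcal{S}))$). Greedy algorithm: start with $\mathcal{S}=\emptyset$; repeat $\Omega$ times: choose $j\in\arg\max_{i\notin\mathcal{S}}\mathrm{trace}(\Sigma(\mathcal{Q}\setminus(\mathcal{S}\cup\{i\})))$ (resp., $j\in\arg\max_{i\notin\mathcal{S}}\mathrm{trace}(\Sigma^*(\mathcal{Q}\setminus(\mathcal{S}\cup\{i\})))$) and set $\mathcal{S}\leftarrow\mathcal{S}\cup\{j\}$. Output $\mathcal{S}$. *)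

(* Defs.v *)
From HB Require Import structures.
From mathcomp Require Import all_boot all_order all_algebra.
From mathcomp Require Import all_classical all_reals all_analysis.

Set Implicit Arguments.
Unset Strict Implicit.
Unset Printing Implicit Defensive.

Import Order.TTheory GRing.Theory Num.Theory.
Import numFieldNormedType.Exports.

Local Open Scope classical_set_scope.
Local Open Scope ring_scope.

Definition is_pseudo_inverse (R : realType) (m n : nat)
    (M : 'M[R]_(m, n)) (X : 'M[R]_(n, m)) : Prop :=
  [/\ M *m X *m M = M, X *m M *m X = X,
      (M *m X)^T = M *m X & (X *m M)^T = X *m M].

(* Moore-Penrose pseudo-inverse. The default 0 is never used: see
   [pseudo_inverseP]; it is [invmx M] when [M] is invertible: see
   [pseudo_inverse_unit]. *)
Definition pseudo_inverse (R : realType) (m n : nat)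
    (M : 'M[R]_(m, n)) : 'M[R]_(n, m) :=
  xget 0 [set X | is_pseudo_inverse M X].

Lemma is_pseudo_inverse_uniq (R : realType) (m n : nat) (M : 'M[R]_(m, n))
    (X Y : 'M[R]_(n, m)) :
  is_pseudo_inverse M X -> is_pseudo_inverse M Y -> X = Y.
Proof.
move=> [MXM XMX sMX sXM] [MYM YMY sMY sYM].
have eqR : M *m X = M *m Y.
  by rewrite -[LHS]sMX -{1}MYM -mulmxA trmx_mul sMX sMY mulmxA MXM.
have eqL : X *m M = Y *m M.
  rewrite -[LHS]sXM -{1}MYM -!mulmxA mulmxA trmx_mul sYM sXM.
  by rewrite -mulmxA [M *m _]mulmxA MXM.
by rewrite -XMX eqL -mulmxA eqR mulmxA YMY.
Qed.

Lemma gram_unitmx (R : realType) (m n : nat) (M : 'M[R]_(m, n)) :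
  row_free M -> M *m M^T \in unitmx.
Proof.
move=> fM; rewrite -row_free_unit -kermx_eq0.
apply/rowV0P => v /sub_kermxP vMM0.
suff vM0 : v *m M = 0 by apply: (row_free_inj fM); rewrite vM0 mul0mx.
have /matrixP/(_ 0 0) : (v *m M) *m (v *m M)^T = 0.
  by rewrite trmx_mul -mulmxA [M *m _]mulmxA mulmxA vMM0 mul0mx.
rewrite mxE [RHS]mxE => /eqP; rewrite psumr_eq0; last first.
  by move=> i _; rewrite [_^T _ _]mxE -expr2 sqr_ge0.
move=> /allP s0; apply/rowP => j; rewrite [RHS]mxE; apply/eqP.
by have := s0 j (mem_index_enum _); rewrite /= [_^T _ _]mxE -expr2 sqrf_eq0.
Qed.

Lemma pseudo_inverseP (R : realType) (m n : nat) (M : 'M[R]_(m, n)) :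
  is_pseudo_inverse M (pseudo_inverse M).
Proof.
suff [X PX] : exists X, is_pseudo_inverse M X by exact: (xgetI 0 PX).
have [r [F [G [eM fF fG]]]] : exists r : nat, exists (F : 'M[R]_(m, r)) (G : 'M[R]_(r, n)),
    [/\ M = F *m G, row_free F^T & row_free G].
  exists (\rank M), (col_base M), (row_base M); split.
  - by rewrite mulmx_base.
  - by rewrite /row_free mxrank_tr; have := col_base_full M.
  - exact: row_base_free.
have uG : G *m G^T \in unitmx by exact: gram_unitmx.
have uF : F^T *m F \in unitmx by rewrite -{2}[F]trmxK; exact: gram_unitmx.
rewrite {}eM.
pose P := invmx (G *m G^T); pose Q := invmx (F^T *m F).
have sP : P^T = P by rewrite /P trmx_inv trmx_mul trmxK.
have sQ : Q^T = Q by rewrite /Q trmx_inv trmx_mul trmxK.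
exists (G^T *m P *m (Q *m F^T)).
have GP k (B : 'M[R]_(k, r)) : B *m G *m G^T *m P = B.
  by rewrite -(mulmxA B) -mulmxA mulmxV ?mulmx1.
have QF k (B : 'M[R]_(k, r)) : B *m Q *m F^T *m F = B.
  by rewrite -(mulmxA _ F^T) -mulmxA mulVmx ?mulmx1.
have e1 : F *m G *m (G^T *m P *m (Q *m F^T)) = F *m Q *m F^T.
  by rewrite !mulmxA GP.
have e2 : G^T *m P *m (Q *m F^T) *m (F *m G) = G^T *m P *m G.
  by rewrite !mulmxA QF.
split.
- by rewrite e1 !mulmxA QF.
- by rewrite e2 !mulmxA GP.
- by rewrite e1 !trmx_mul trmxK sQ mulmxA.
- by rewrite e2 !trmx_mul trmxK sP mulmxA.
Qed.

Lemma pseudo_inverse_unit (R : realType) (n : nat) (M : 'M[R]_n) :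
  M \in unitmx -> pseudo_inverse M = invmx M.
Proof.
move=> uM; apply: is_pseudo_inverse_uniq (pseudo_inverseP M) _.
by split; rewrite ?mulmxV ?mulVmx ?mul1mx ?trmx1.
Qed.

Record kf_system (R : realType) (n q : nat) := KFSystem {
  kfA : 'M[R]_n;
  kfW : 'M[R]_n;
  kfC : 'M[R]_(q, n);
  kfV : 'M[R]_q;
  kfPi0 : 'M[R]_n }.

Definition sensC (R : realType) (n q : nat) (Y : kf_system R n q)
    (T : {set 'I_q}) : 'M[R]_(#|T|, n) :=
  rowsub (@enum_val _ (mem T)) (kfC Y).

Definition sensV (R : realType) (n q : nat) (Y : kf_system R n q)
    (T : {set 'I_q}) : 'M[R]_#|T| :=
  mxsub (@enum_val _ (mem T)) (@enum_val _ (mem T)) (kfV Y).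

Definition meas_update (R : realType) (n q : nat) (Y : kf_system R n q)
    (T : {set 'I_q}) (Sigma : 'M[R]_n) : 'M[R]_n :=
  let CT := sensC Y T in
  Sigma - Sigma *m CT^T
          *m pseudo_inverse (CT *m Sigma *m CT^T + sensV Y T)
          *m CT *m Sigma.

(* [prior_cov Y T k] is Sigma_{k|k-1}; [post_cov Y T k] is Sigma_{k|k}. *)
Fixpoint prior_cov (R : realType) (n q : nat) (Y : kf_system R n q)
    (T : {set 'I_q}) (k : nat) : 'M[R]_n :=
  if k is k'.+1 then
    kfA Y *m meas_update Y T (prior_cov Y T k') *m (kfA Y)^T + kfW Y
  else kfPi0 Y.

Definition post_cov (R : realType) (n q : nat) (Y : kf_system R n q)
    (T : {set 'I_q}) (k : nat) : 'M[R]_n :=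
  meas_update Y T (prior_cov Y T k).

Definition steady_prior (R : realType) (n q : nat) (Y : kf_system R n q)
    (T : {set 'I_q}) : 'M[R]_n :=
  lim (prior_cov Y T k @[k --> \oo]).

Definition steady_post (R : realType) (n q : nat) (Y : kf_system R n q)
    (T : {set 'I_q}) : 'M[R]_n :=
  lim (post_cov Y T k @[k --> \oo]).

(* [F T] is the value to be maximized when [T] is the set of surviving
   sensors, so an attack [S] is worth [F (~: S)]. *)
Definition optimal_attack (R : realType) (q : nat) (F : {set 'I_q} -> R)
    (Omega : nat) (S : {set 'I_q}) : Prop :=
  (#|S| <= Omega)%N /\
  forall S' : {set 'I_q}, (#|S'| <= Omega)%N -> F (~: S')%SET <= F (~: S)%SET.

(* A relation and not a function, because the arg max of a step need not be
   unique: every way of breaking ties is allowed. *)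
Inductive greedy_attack (R : realType) (q : nat) (F : {set 'I_q} -> R) :
    nat -> {set 'I_q} -> Prop :=
| greedy_start : greedy_attack F 0 finset.set0
| greedy_step (m : nat) (S : {set 'I_q}) (j : 'I_q) :
    greedy_attack F m S ->
    j \notin S ->
    (forall i : 'I_q, i \notin S ->
      F (~: (i |: S))%SET <= F (~: (j |: S))%SET) ->
    greedy_attack F m.+1 (j |: S)%SET.

Lemma optimal_attack_exists (R : realType) (q : nat) (F : {set 'I_q} -> R)
    (Omega : nat) : exists S, optimal_attack F Omega S.
Proof.
have h0 : (#|@finset.set0 'I_q| <= Omega)%N by rewrite cards0.
pose G (S : {set 'I_q}) := F (~: S)%SET.
case: (@arg_maxP _ _ _ finset.set0 (fun S : {set 'I_q} => #|S| <= Omega)%N G h0).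
by move=> S hS hmax; exists S; split.
Qed.

Lemma greedy_attack_exists (R : realType) (q : nat) (F : {set 'I_q} -> R)
    (Omega : nat) : (Omega <= q)%N -> exists S, greedy_attack F Omega S.
Proof.
move=> le_q.
suff [S [_ gS]] : exists S : {set 'I_q}, #|S| = Omega /\
    greedy_attack F Omega S.
  by exists S.
elim: Omega le_q => [|m IH] le_q.
  by exists finset.set0; rewrite cards0; split=> //; exact: greedy_start.
have [S [cS gS]] := IH (ltnW le_q).
have /card_gt0P[i0] : (0 < #|~: S|)%N.
  by rewrite cardsCs finset.setCK card_ord cS subn_gt0.
rewrite inE => hi0.
pose G i := F (~: (i |: S))%SET.
case: (@arg_maxP _ _ _ i0 (fun i => i \notin S) G hi0).
move=> j jS hj; exists (j |: S)%SET; split; first by rewrite cardsU1 jS cS.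
exact: greedy_step.
Qed.

Definition mx_of_rows (R : realType) (m n : nat) (s : seq (seq R)) :
    'M[R]_(m, n) :=
  \matrix_(i < m, j < n) nth 0 (nth [::] s i) j.

Definition kfsa_instance (R : realType) (lambda1 h : R) : kf_system R 3 4 :=
  {| kfA := mx_of_rows 3 3 [:: [:: lambda1; 0; 0];
                               [:: 0;       0; 0];
                               [:: 0;       0; 0]];
     kfW := 1%:M;
     kfC := mx_of_rows 4 3 [:: [:: 1; h; h];
                               [:: 1; 0; h];
                               [:: 0; 1; 0];
                               [:: 0; 0; 1]];
     kfV := 0;
     kfPi0 := 1%:M |}.

(* Main.v *)
(** All the prior covariances are [diag(s, 1, 1)], because [A] only keeps the
    first coordinate, and [s] obeys a scalar recursion [s' = 1 + lambda1^2 p(s)]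
    where [p(s)] is the posterior variance of the first coordinate. As there is
    no measurement noise, the update depends only on the row span of the sensors
    in use. Any two, or all three, of sensors 1, 2, 3 have the same span, which
    leaves a variance [p(s) = s h^2 / (s + h^2)]; any two of them together with
    sensor 4 determine the state. Hence the greedy algorithm removes sensor 4
    first, and whichever sensor it removes next does no further damage: the
    traces tend to 3 and 1. Removing sensors 1 and 2 instead leaves the first
    coordinate unobserved, with [s = 1 / (1 - lambda1^2)], the largest value
    that the recursion allows. *)

Require Import Defs.
From mathcomp Require Import all_boot all_order all_algebra.
From mathcomp Require Import all_classical all_reals all_analysis.
From mathcomp Require Import ring lra.
Import Order.TTheory GRing.Theory Num.Theory.
Import numFieldNormedType.Exports.
Local Open Scope classical_set_scope.
Local Open Scope ring_scope.

(** * Characterization of the noiseless measurement update *)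

Definition definite_mx {R : realType} {n : nat} (M : 'M[R]_n) : Prop :=
  forall v : 'rV[R]_n, v *m M *m v^T = 0 -> v = 0.

Lemma definite_mx_congr_eq0 {R : realType} {m n : nat} (M : 'M[R]_n)
    (B : 'M[R]_(m, n)) :
  definite_mx M -> B *m M *m B^T = 0 -> B = 0.
Proof.
move=> dM BMB; apply/row_matrixP => i; rewrite row0; apply: dM.
rewrite tr_row -[X in X *m _ *m _]/(row i B) rowE -!mulmxA colE.
by rewrite [B *m _]mulmxA [_ *m (B^T *m _)]mulmxA BMB mul0mx mulmx0.
Qed.

(** Avoids computing pseudo-inverses: the sensors in use annihilate the update, and it differs from
    [Sigma] by an element of the column space of [Sigma *m D^T], where [D] is the matrix of those
    sensors. Two such matrices differ by some [Sigma *m (D^T *m E)] killed by [D], so definiteness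
    makes them equal. [Z] is the gain padded with zero rows, which keeps the enumeration of [T] out
    of concrete cases. *)
Lemma meas_update_uniq {R : realType} {n q : nat} (Y : kf_system R n q)
    (T : {set 'I_q}) (Sigma U : 'M[R]_n) (Z : 'M[R]_(q, n)) :
  kfV Y = 0 -> Sigma^T = Sigma -> definite_mx Sigma ->
  (forall i, i \in T -> row i (kfC Y) *m U = 0) ->
  (forall i, i \notin T -> row i Z = 0) ->
  Sigma - U = Sigma *m (kfC Y)^T *m Z ->
  meas_update Y T Sigma = U.
Proof.
move=> V0 sS dS CU Z0 SU; rewrite /meas_update.
set D := sensC Y T.
have -> : sensV Y T = 0 by apply/matrixP=> i j; rewrite mxE V0 !mxE.
rewrite addr0; set G := D *m Sigma *m D^T.
have [GXG _ _ _] := pseudo_inverseP G.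
set X := pseudo_inverse G in GXG *.
have sG : G^T = G by rewrite /G !trmx_mul trmxK sS mulmxA.
have sGX : (G *m X)^T = G *m X by have [] := pseudo_inverseP G.
have DU : D *m U = 0.
  apply/row_matrixP=> i; rewrite row0 row_mul row_rowsub.
  by apply: CU; exact: enum_valP.
have DZ : D^T *m rowsub (@enum_val _ (mem T)) Z = (kfC Y)^T *m Z.
  apply/matrixP=> i j; rewrite !mxE.
  under eq_bigr do rewrite !mxE.
  rewrite -(big_enum_val (fun k => kfC Y k i * Z k j)) /= big_mkcond /=.
  apply: eq_bigr => k _; rewrite mxE; case: ifPn => // /Z0 /rowP/(_ j).
  by rewrite !mxE => ->; rewrite mulr0.
(* [G] may be singular, as the rows in use may be dependent. Still, [G *m X] fixes [D], since the
   residual has zero Gram matrix for [Sigma]. *)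
have B0 : D - G *m X *m D = 0.
  apply: (@definite_mx_congr_eq0 _ _ _ Sigma) => //.
  rewrite linearB /= trmx_mul sGX mulmxBr.
  rewrite [_ *m (D^T *m _)]mulmxA.
  have -> : (D - G *m X *m D) *m Sigma *m D^T = 0.
    rewrite !mulmxBl -/G -(mulmxA _ Sigma) -(mulmxA _ D) (mulmxA D) -/G.
    by rewrite GXG subrr.
  by rewrite mul0mx subr0.
set U' := (X in X = U).
have DU' : D *m U' = 0.
  rewrite /U' mulmxBr !mulmxA -/G -mulmxBl.
  by rewrite B0 mul0mx.
pose E := rowsub (@enum_val _ (mem T)) Z - X *m D *m Sigma.
have eUU : U' - U = Sigma *m (D^T *m E).
  rewrite /E mulmxBr DZ mulmxBr (mulmxA Sigma (kfC Y)^T) -SU /U' !mulmxA.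
  by rewrite addrAC.
have DE0 : (D^T *m E)^T = 0.
  apply: (@definite_mx_congr_eq0 _ _ _ Sigma) => //.
  rewrite trmxK -mulmxA -eUU trmx_mul trmxK -mulmxA mulmxBr DU DU'.
  by rewrite subrr mulmx0.
apply/eqP; rewrite -subr_eq0 eUU -[D^T *m E]trmxK DE0 trmx0 mulmx0 //.
Qed.

(** * Reduction of the filter to a scalar recursion *)

Definition state_cov {R : realType} (s : R) : 'M[R]_3 :=
  mx_of_rows 3 3 [:: [:: s; 0; 0]; [:: 0; 1; 0]; [:: 0; 0; 1]].

(** Lets a matrix limit follow from the limit of the scalar [s]. *)
Lemma state_cov_affine {R : realType} (s : R) :
  state_cov s = s *: delta_mx 0 0 + state_cov 0.
Proof.
apply/matrixP => -[[|[|[|//]]] hi] -[[|[|[|//]]] hj]; rewrite !mxE /=; ring.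
Qed.

Lemma mxtrace_state_cov {R : realType} (s : R) : \tr (state_cov s) = 2 + s.
Proof. rewrite /mxtrace !big_ord_recl big_ord0 !mxE /=; ring. Qed.

Lemma tr_state_cov {R : realType} (s : R) : (state_cov s)^T = state_cov s.
Proof.
by apply/matrixP => -[[|[|[|//]]] hi] -[[|[|[|//]]] hj]; rewrite !mxE.
Qed.

Lemma definite_state_cov {R : realType} (s : R) :
  0 < s -> definite_mx (state_cov s).
Proof.
move=> s0 v /matrixP/(_ 0 0); rewrite !mxE !big_ord_recl big_ord0 !mxE.
rewrite !big_ord_recl !big_ord0 !mxE /= => e.
have {}e : s * v 0 0 ^+ 2 + v 0 (lift ord0 ord0) ^+ 2
    + v 0 (lift ord0 (lift ord0 ord0)) ^+ 2 = 0 by rewrite -e; ring.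
have e0 : v 0 0 = 0.
  apply/eqP; rewrite -sqrf_eq0; apply/eqP.
  have := sqr_ge0 (v 0 0); have := sqr_ge0 (v 0 (lift ord0 ord0)).
  have := sqr_ge0 (v 0 (lift ord0 (lift ord0 ord0))); nra.
rewrite e0 expr0n mulr0 add0r in e.
have /eqP : v 0 (lift ord0 ord0) ^+ 2 == 0.
  by move/eqP: e; rewrite paddr_eq0 ?sqr_ge0 // => /andP[].
move=> /eqP; rewrite sqrf_eq0 => /eqP e1.
rewrite e1 expr0n add0r in e; move/eqP: e; rewrite sqrf_eq0 => /eqP e2.
apply/rowP => -[[|[|[|//]]] hi]; rewrite mxE.
- by rewrite -e0; congr (v _ _); apply: val_inj.
- by rewrite -e1; congr (v _ _); apply: val_inj.
- by rewrite -e2; congr (v _ _); apply: val_inj.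
Qed.

Lemma time_update {R : realType} (lambda1 h : R) (M : 'M[R]_3) :
  kfA (kfsa_instance lambda1 h) *m M *m (kfA (kfsa_instance lambda1 h))^T
  + kfW (kfsa_instance lambda1 h) = state_cov (1 + lambda1 ^+ 2 * M 0 0).
Proof.
apply/matrixP => -[[|[|[|//]]] hi] -[[|[|[|//]]] hj];
  do 3!rewrite ?mxE /= ?big_ord_recl ?big_ord0; ring.
Qed.

Lemma mxtrace_affine {R : realType} {n : nat} (c : R) (M N : 'M[R]_n) :
  \tr (c *: M + N) = c * \tr M + \tr N.
Proof. by rewrite mxtraceD mxtraceZ. Qed.

(** The scalar sequence starts at 1, is nondecreasing because [p] is monotone, and is bounded
    because [p s <= s]; continuity of [f] makes its limit a fixed point. The affine form
    [f s *: M + N] covers every set of sensors met below. *)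
Lemma steady_state {R : realType} (lambda1 h : R) (T : {set 'I_4})
    (f : R -> R) (M N : 'M[R]_3) (p := fun s => f s * M 0 0 + N 0 0) :
  `|lambda1| < 1 ->
  (forall s, 1 <= s ->
     meas_update (kfsa_instance lambda1 h) T (state_cov s) = f s *: M + N) ->
  (forall s, 1 <= s -> 0 <= p s <= s) ->
  (forall s t, 1 <= s -> s <= t -> p s <= p t) ->
  (forall s, 1 <= s -> {for s, continuous f}) ->
  exists l : R,
    [/\ 1 <= l, l <= 1 / (1 - lambda1 ^+ 2), l = 1 + lambda1 ^+ 2 * p l,
        \tr (steady_prior (kfsa_instance lambda1 h) T) = 2 + l &
        \tr (steady_post (kfsa_instance lambda1 h) T) = f l * \tr M + \tr N].
Proof.
move=> hl upd p_bnd p_mono f_cont.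
have l1 : lambda1 ^+ 2 < 1 by rewrite -real_normK ?num_real // expr_lt1.
have l0 : 0 <= lambda1 ^+ 2 by exact: sqr_ge0.
pose u := fix u k := if k is k'.+1 then 1 + lambda1 ^+ 2 * p (u k') else 1.
have u_ge1 k : 1 <= u k.
  elim: k => //= k IH; have /andP[p0 _] := p_bnd _ IH.
  by rewrite lerDl mulr_ge0.
have u_le k : u k <= 1 / (1 - lambda1 ^+ 2).
  elim: k => [|k IH] /=; first by rewrite ler_pdivlMr; lra.
  have /andP[_ pu] := p_bnd _ (u_ge1 k).
  (* The bound is the fixed point of [s = 1 + lambda1 ^+ 2 * s], the recursion in which measuring
     brings no information. *)
  have -> : 1 / (1 - lambda1 ^+ 2)
      = 1 + lambda1 ^+ 2 * (1 / (1 - lambda1 ^+ 2)).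
    by field; rewrite subr_eq0 gt_eqF.
  by rewrite lerD2l ler_wpM2l // (le_trans pu).
have uS k : u k <= u k.+1.
  elim: k => [|k IH]; first exact: u_ge1.
  by rewrite /= lerD2l ler_wpM2l // p_mono.
have u_cvg : cvgn u.
  apply: nondecreasing_is_cvgn; first exact/nondecreasing_seqP.
  by exists (1 / (1 - lambda1 ^+ 2)) => _ [k _ <-].
have prior_u k : prior_cov (kfsa_instance lambda1 h) T k = state_cov (u k).
  elim: k => [|k IH].
    by apply/matrixP => -[[|[|[|//]]] hi] -[[|[|[|//]]] hj]; rewrite !mxE.
  rewrite [LHS]/= IH upd // (time_update lambda1 h).
  by have -> : (f (u k) *: M + N) 0 0 = p (u k) by rewrite !mxE.
set l := limn u in u_cvg.
have l_ge1 : 1 <= l by apply: limr_ge => //; exact: nearW.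
have fu : f (u k) @[k --> \oo] --> f l.
  by apply: continuous_cvg; [exact: f_cont | exact: u_cvg].
exists l; split => //.
- by apply: limr_le => //; exact: nearW.
- have h1 : u k.+1 @[k --> \oo] --> l by rewrite (cvg_shiftS u).
  apply: (cvg_unique _ h1) => //=.
  apply: cvgD; first exact: cvg_cst.
  apply: cvgM; first exact: cvg_cst.
  apply: cvgD; last exact: cvg_cst.
  by apply: cvgM => //; exact: cvg_cst.
- rewrite /steady_prior (_ : prior_cov _ _ = state_cov \o u); last exact/funext.
  rewrite -mxtrace_state_cov; congr (\tr _).
  apply: cvg_lim => //; rewrite state_cov_affine.
  under eq_fun do rewrite /= state_cov_affine.
  by apply: cvgD; [exact: cvgZr_tmp | exact: cvg_cst].
- rewrite -mxtrace_affine /steady_post; congr (\tr _).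
  apply: cvg_lim => //.
  under eq_fun do rewrite /post_cov prior_u upd //.
  by apply: cvgD; [exact: cvgZr_tmp | exact: cvg_cst].
Qed.

(** * Explicit measurement updates of the instance *)

Lemma forall_ord4 (P : 'I_4 -> Prop) :
  P 0 -> P 1 -> P 2 -> P 3 -> forall i, P i.
Proof.
move=> P0 P1 P2 P3 [[|[|[|[|//]]]] hi].
- by rewrite (_ : Ordinal hi = 0) //; apply: val_inj.
- by rewrite (_ : Ordinal hi = 1) //; apply: val_inj.
- by rewrite (_ : Ordinal hi = 2) //; apply: val_inj.
- by rewrite (_ : Ordinal hi = 3) //; apply: val_inj.
Qed.

Lemma forall_ord3 (P : 'I_3 -> Prop) : P 0 -> P 1 -> P 2 -> forall i, P i.
Proof.
move=> P0 P1 P2 [[|[|[|//]]] hi].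
- by rewrite (_ : Ordinal hi = 0) //; apply: val_inj.
- by rewrite (_ : Ordinal hi = 1) //; apply: val_inj.
- by rewrite (_ : Ordinal hi = 2) //; apply: val_inj.
Qed.

Lemma sum_ord3 {V : nmodType} (F : 'I_3 -> V) :
  \sum_i F i = F 0 + F 1 + F 2.
Proof.
rewrite !big_ord_recl big_ord0 addr0 addrA.
by do ?congr (_ + _); congr F; apply: val_inj.
Qed.

Lemma sum_ord4 {V : nmodType} (F : 'I_4 -> V) :
  \sum_i F i = F 0 + F 1 + F 2 + F 3.
Proof.
rewrite !big_ord_recl big_ord0 addr0 !addrA.
by do ?congr (_ + _); congr F; apply: val_inj.
Qed.

(** The hypotheses of [meas_update_uniq] written entrywise for the concrete [C], so that a witness
    [Z] and field arithmetic settle each case. *)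
Lemma meas_update_instance {R : realType} (lambda1 h s : R) (T : {set 'I_4})
    (U : 'M[R]_3) (Z : 'M[R]_(4, 3)) :
  0 < s ->
  (forall j, [/\ 0 \in T -> U 0 j + h * U 1 j + h * U 2 j = 0,
                 1 \in T -> U 0 j + h * U 2 j = 0,
                 2 \in T -> U 1 j = 0 & 3 \in T -> U 2 j = 0]) ->
  (forall i j, i \notin T -> Z i j = 0) ->
  (forall j, [/\ state_cov s 0 j - U 0 j = s * (Z 0 j + Z 1 j),
                 state_cov s 1 j - U 1 j = h * Z 0 j + Z 2 j &
                 state_cov s 2 j - U 2 j = h * Z 0 j + h * Z 1 j + Z 3 j]) ->
  meas_update (kfsa_instance lambda1 h) T (state_cov s) = U.
Proof.
move=> s0 CU Z0 SU; apply: (@meas_update_uniq _ _ _ _ _ _ _ Z) => //.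
- exact: tr_state_cov.
- exact: definite_state_cov.
- move=> i iT; apply/rowP => j; have [c0 c1 c2 c3] := CU j.
  rewrite [LHS]mxE sum_ord3 !mxE.
  elim/forall_ord4: i iT => /= [/c0|/c1|/c2|/c3] e; rewrite -[RHS]e; ring.
- by move=> i iT; apply/rowP => j; rewrite !mxE Z0.
- apply/matrixP => i j; have [c0 c1 c2] := SU j.
  rewrite [LHS]mxE [X in _ + X]mxE.
  rewrite -mulmxA [RHS]mxE sum_ord3 ![(_^T *m Z) _ _]mxE !sum_ord4.
  by elim/forall_ord3: i; rewrite ?c0 ?c1 ?c2 !mxE /=; ring.
Qed.

(* The paper's sensors 1, 2, 3, 4 are the ordinals 0, 1, 2, 3. *)
Definition two_of_first_three (T : {set 'I_4}) : bool :=
  [|| (0 \in T) && (1 \in T), (0 \in T) && (2 \in T) | (1 \in T) && (2 \in T)].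

(* Sensors of the paper's {1, 2, 3} reveal the state up to a multiple of
   (h, 0, -1), and {1, 4} up to a multiple of (h, -1, 0). *)
Definition line_cov13 {R : realType} (h : R) : 'M[R]_3 :=
  mx_of_rows 3 3 [:: [:: h ^+ 2; 0; - h]; [:: 0; 0; 0]; [:: - h; 0; 1]].

(** When the noiseless sensors leave only the line of a vector v undetermined, the posterior is v
    v^T divided by v^T Sigma^-1 v. For v = (h, 0, -1) the divisor is h^2 / s + 1, whence the scalar
    factor. *)
Lemma meas_update_two {R : realType} (lambda1 h s : R) (T : {set 'I_4}) :
  0 < h -> 0 < s -> two_of_first_three T -> 3 \notin T ->
  meas_update (kfsa_instance lambda1 h) T (state_cov s)
  = (s / (s + h ^+ 2)) *: line_cov13 h + 0.
Proof.
move=> h0 s0 T2 /negbTE T3.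
have hN0 : h != 0 by rewrite gt_eqF.
have shN0 : s + h ^+ 2 != 0 by rewrite gt_eqF // addr_gt0 ?exprn_gt0.
(* The first row of [Sigma - U] is s times (z, 0, w), so rows 0 and 1 of the gain must add up to (z,
   0, w). *)
pose z : R := s / (s + h ^+ 2); pose w : R := h / (s + h ^+ 2).
case/or3P: T2 => /andP[Ti Tj].
(* Rows 0 and 1 of [C] differ by (0, h, 0); dividing by h recovers the middle coordinate, hence the
   entries [h^-1]. *)
- apply: (@meas_update_instance _ _ _ _ _ _
    (mx_of_rows 4 3 [:: [:: 0; h^-1; 0]; [:: z; - h^-1; w]; [:: 0; 0; 0];
                        [:: 0; 0; 0]])) => //.
  + by elim/forall_ord3; split; rewrite ?T3 // => _; rewrite !mxE /=; field.
  + by elim/forall_ord4; elim/forall_ord3; rewrite ?Ti ?Tj ?mxE.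
  + by elim/forall_ord3; split; rewrite /z /w !mxE /=; field; rewrite ?hN0.
- apply: (@meas_update_instance _ _ _ _ _ _
    (mx_of_rows 4 3 [:: [:: z; 0; w]; [:: 0; 0; 0]; [:: - h * z; 1; - h * w];
                        [:: 0; 0; 0]])) => //.
  + by elim/forall_ord3; split; rewrite ?T3 // => _; rewrite !mxE /=; field.
  + by elim/forall_ord4; elim/forall_ord3; rewrite ?Ti ?Tj ?mxE.
  + by elim/forall_ord3; split; rewrite /z /w !mxE /=; field; rewrite ?hN0.
- apply: (@meas_update_instance _ _ _ _ _ _
    (mx_of_rows 4 3 [:: [:: 0; 0; 0]; [:: z; 0; w]; [:: 0; 1; 0];
                        [:: 0; 0; 0]])) => //.
  + by elim/forall_ord3; split; rewrite ?T3 // => _; rewrite !mxE /=; field.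
  + by elim/forall_ord4; elim/forall_ord3; rewrite ?Ti ?Tj ?mxE.
  + by elim/forall_ord3; split; rewrite /z /w !mxE /=; field; rewrite ?hN0.
Qed.

(** The rows in use span the whole space: each witness [Z] is supported on [T] and satisfies C^T Z =
    I. *)
Lemma meas_update_full {R : realType} (lambda1 h s : R) (T : {set 'I_4}) :
  0 < h -> 0 < s -> two_of_first_three T -> 3 \in T ->
  meas_update (kfsa_instance lambda1 h) T (state_cov s) = 0.
Proof.
move=> h0 s0 T2 T3.
have hN0 : h != 0 by rewrite gt_eqF.
case/or3P: T2 => /andP[Ti Tj].
- apply: (@meas_update_instance _ _ _ _ _ _
    (mx_of_rows 4 3 [:: [:: 0; h^-1; 0]; [:: 1; - h^-1; 0]; [:: 0; 0; 0];
                        [:: - h; 0; 1]])) => //.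
  + by move=> j; split=> _; rewrite !mxE /=; ring.
  + by elim/forall_ord4; elim/forall_ord3; rewrite ?Ti ?Tj ?T3 ?mxE.
  + by elim/forall_ord3; split; rewrite !mxE /=; field.
- apply: (@meas_update_instance _ _ _ _ _ _
    (mx_of_rows 4 3 [:: [:: 1; 0; 0]; [:: 0; 0; 0]; [:: - h; 1; 0];
                        [:: - h; 0; 1]])) => //.
  + by move=> j; split=> _; rewrite !mxE /=; ring.
  + by elim/forall_ord4; elim/forall_ord3; rewrite ?Ti ?Tj ?T3 ?mxE.
  + by elim/forall_ord3; split; rewrite !mxE /=; field.
- apply: (@meas_update_instance _ _ _ _ _ _
    (mx_of_rows 4 3 [:: [:: 0; 0; 0]; [:: 1; 0; 0]; [:: 0; 1; 0];
                        [:: - h; 0; 1]])) => //.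
  + by move=> j; split=> _; rewrite !mxE /=; ring.
  + by elim/forall_ord4; elim/forall_ord3; rewrite ?Ti ?Tj ?T3 ?mxE.
  + by elim/forall_ord3; split; rewrite !mxE /=; field.
Qed.

Definition line_cov12 {R : realType} (h : R) : 'M[R]_3 :=
  mx_of_rows 3 3 [:: [:: h ^+ 2; - h; 0]; [:: - h; 1; 0]; [:: 0; 0; 0]].

Lemma meas_update_03 {R : realType} (lambda1 h s : R) (T : {set 'I_4}) :
  0 < h -> 0 < s -> 0 \in T -> 1 \notin T -> 2 \notin T -> 3 \in T ->
  meas_update (kfsa_instance lambda1 h) T (state_cov s)
  = (s / (s + h ^+ 2)) *: line_cov12 h + 0.
Proof.
move=> h0 s0 T0 /negbTE T1 /negbTE T2 T3.
have shN0 : s + h ^+ 2 != 0 by rewrite gt_eqF // addr_gt0 ?exprn_gt0.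
pose z : R := s / (s + h ^+ 2); pose w : R := h / (s + h ^+ 2).
apply: (@meas_update_instance _ _ _ _ _ _
  (mx_of_rows 4 3 [:: [:: z; w; 0]; [:: 0; 0; 0]; [:: 0; 0; 0];
                      [:: - h * z; - h * w; 1]])) => //.
- by elim/forall_ord3; split; rewrite ?T1 ?T2 // => _; rewrite !mxE /=; field.
- by elim/forall_ord4; elim/forall_ord3; rewrite ?T0 ?T3 ?mxE.
- by elim/forall_ord3; split; rewrite /z /w !mxE /=; field.
Qed.

(** Row 1 minus h times row 3 is the first coordinate, so only the middle coordinate stays
    uncertain, with its prior variance 1. *)
Lemma meas_update_13 {R : realType} (lambda1 h s : R) (T : {set 'I_4}) :
  0 < s -> 0 \notin T -> 1 \in T -> 2 \notin T -> 3 \in T ->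
  meas_update (kfsa_instance lambda1 h) T (state_cov s) = delta_mx 1 1.
Proof.
move=> s0 /negbTE T0 T1 /negbTE T2 T3.
apply: (@meas_update_instance _ _ _ _ _ _
  (mx_of_rows 4 3 [:: [:: 0; 0; 0]; [:: 1; 0; 0]; [:: 0; 0; 0];
                      [:: - h; 0; 1]])) => //.
- by elim/forall_ord3; split; rewrite ?T0 ?T2 // => _; rewrite !mxE /=; ring.
- by elim/forall_ord4; elim/forall_ord3; rewrite ?T1 ?T3 ?mxE.
- by elim/forall_ord3; split; rewrite !mxE /=; ring.
Qed.

Lemma meas_update_23 {R : realType} (lambda1 h s : R) (T : {set 'I_4}) :
  0 < s -> 0 \notin T -> 1 \notin T -> 2 \in T -> 3 \in T ->
  meas_update (kfsa_instance lambda1 h) T (state_cov s) = s *: delta_mx 0 0.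
Proof.
move=> s0 /negbTE T0 /negbTE T1 T2 T3.
apply: (@meas_update_instance _ _ _ _ _ _
  (mx_of_rows 4 3 [:: [:: 0; 0; 0]; [:: 0; 0; 0]; [:: 0; 1; 0];
                      [:: 0; 0; 1]])) => //.
- by elim/forall_ord3; split; rewrite ?T0 ?T1 // => _; rewrite !mxE /=; ring.
- by elim/forall_ord4; elim/forall_ord3; rewrite ?T2 ?T3 ?mxE.
- by elim/forall_ord3; split; rewrite !mxE /=; ring.
Qed.

(** * Steady state traces for each kind of surviving set *)

Lemma steady_line {R : realType} (lambda1 h : R) (T : {set 'I_4})
    (M : 'M[R]_3) (Y := kfsa_instance lambda1 h) :
  0 < `|lambda1| < 1 -> 0 < h -> M 0 0 = h ^+ 2 -> \tr M = 1 + h ^+ 2 ->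
  (forall s, 0 < s ->
     meas_update Y T (state_cov s) = (s / (s + h ^+ 2)) *: M + 0) ->
  [/\ 3 < \tr (steady_prior Y T),
      \tr (steady_prior Y T) <= 3 + h ^+ 2,
      \tr (steady_prior Y T) <= 2 + 1 / (1 - lambda1 ^+ 2),
      1 <= \tr (steady_post Y T) <= 1 + h ^+ 2 &
      \tr (steady_post Y T) <= 1 / (1 - lambda1 ^+ 2)].
Proof.
move=> /andP[hl0 hl1] h0 M00 trM upd.
have hh : 0 < h ^+ 2 by rewrite exprn_gt0.
have l1 : lambda1 ^+ 2 < 1 by rewrite -real_normK ?num_real // expr_lt1.
have l0 : 0 < lambda1 ^+ 2 by rewrite exprn_even_gt0 //= -normr_gt0.
have sh0 s : 1 <= s -> 0 < s + h ^+ 2.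
  by move=> s1; rewrite addr_gt0 // (lt_le_trans ltr01).
have [|||||l [l_ge1 l_le l_fix -> ->]] :=
    @steady_state R lambda1 h T (fun s => s / (s + h ^+ 2)) M 0 => //.
- by move=> s s1; apply: upd; apply: lt_le_trans s1.
- move=> s s1; have s0 := lt_le_trans ltr01 s1; have := sh0 _ s1 => s'.
  have c0 : 0 <= s / (s + h ^+ 2) by rewrite divr_ge0 // ltW.
  rewrite M00 mxE addr0; apply/andP; split; first by rewrite mulr_ge0 // ltW.
  rewrite -[leRHS](@divfK _ (s + h ^+ 2)).
    by rewrite mulrDr lerDr mulr_ge0 // ltW.
  by rewrite gt_eqF.
- move=> s t s1 st; have t1 := le_trans s1 st.
  rewrite M00 mxE !addr0 ler_pM2r // ler_pdivrMr ?sh0 // mulrAC.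
  rewrite ler_pdivlMr ?sh0 // !mulrDr mulrC lerD2l.
  by rewrite ler_pM2r.
- move=> s s1; apply: cvgM; first exact: cvg_id.
  apply: cvgV; first by rewrite gt_eqF ?sh0.
  by apply: cvgD; [exact: cvg_id | exact: cvg_cst].
rewrite M00 mxE addr0 in l_fix.
have ll0 := lt_le_trans ltr01 l_ge1.
have lh := sh0 _ l_ge1.
have q0 : 0 < l / (l + h ^+ 2) by rewrite divr_gt0.
have q1 : l / (l + h ^+ 2) <= 1 by rewrite ler_pdivrMr // mul1r lerDl ltW.
have qM : l / (l + h ^+ 2) * (l + h ^+ 2) = l by rewrite divfK // gt_eqF.
(* The left side is the posterior trace; [1 <= l] bounds it by [l], hence by 1 / (1 - lambda1^2). *)
have ql : l / (l + h ^+ 2) * (1 + h ^+ 2) <= l.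
  by rewrite -[leRHS]qM ler_pM2l // lerD2r.
rewrite trM mxtrace0 addr0; set c := l / _ in l_fix q0 q1 qM ql *.
(* This excess over 3 of the prior trace is positive because [lambda1] and h are nonzero; it is what
   makes the first greedy choice strict. *)
have c0 : 0 < lambda1 ^+ 2 * (c * h ^+ 2) by rewrite mulr_gt0 // mulr_gt0.
split => //.
- lra.
- have : c * h ^+ 2 <= h ^+ 2 by rewrite ler_piMl // ltW.
  have : lambda1 ^+ 2 * (c * h ^+ 2) <= c * h ^+ 2.
    exact: ler_piMl (ltW (mulr_gt0 q0 hh)) (ltW l1).
  lra.
- lra.
- apply/andP; split; last by rewrite ger_pMl // addr_gt0.
  rewrite /c mulrAC ler_pdivlMr // mul1r mulrDr mulr1 lerD2l.
  by rewrite ler_peMl // ltW.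
- exact: le_trans l_le.
Qed.

Lemma steady_const {R : realType} (lambda1 h : R) (T : {set 'I_4})
    (N : 'M[R]_3) (Y := kfsa_instance lambda1 h) :
  `|lambda1| < 1 -> N 0 0 = 0 ->
  (forall s, 0 < s -> meas_update Y T (state_cov s) = N) ->
  \tr (steady_prior Y T) = 3 /\ \tr (steady_post Y T) = \tr N.
Proof.
move=> hl N00 upd.
have [|||||l [_ _ l_fix -> ->]] :=
    @steady_state R lambda1 h T (fun=> 0) 0 N => //.
- by move=> s s1; rewrite scale0r add0r upd // (lt_le_trans ltr01).
- by move=> s s1; rewrite mul0r add0r N00 lexx (le_trans ler01).
- by move=> s s1; exact: cvg_cst.
by rewrite l_fix N00 !mul0r !add0r mulr0; split => //; ring.
Qed.

Lemma steady_23 {R : realType} (lambda1 h : R) (T : {set 'I_4})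
    (Y := kfsa_instance lambda1 h) :
  `|lambda1| < 1 -> 0 \notin T -> 1 \notin T -> 2 \in T -> 3 \in T ->
  \tr (steady_prior Y T) = 2 + 1 / (1 - lambda1 ^+ 2) /\
  \tr (steady_post Y T) = 1 / (1 - lambda1 ^+ 2).
Proof.
move=> hl T0 T1 T2 T3.
have l1 : lambda1 ^+ 2 < 1 by rewrite -real_normK ?num_real // expr_lt1.
have [|||||l [_ _ + -> ->]] :=
    @steady_state R lambda1 h T id (delta_mx 0 0) 0 => //.
- by move=> s s1; rewrite addr0 meas_update_23 // (lt_le_trans ltr01).
- by move=> s s1; rewrite !mxE /= mulr1 addr0 lexx (le_trans ler01).
- by move=> s t s1 st; rewrite !mxE /= !mulr1 !addr0.
- by move=> s s1; exact: cvg_id.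
rewrite !mxE /= mulr1 addr0 => l_fix.
have -> : l = 1 / (1 - lambda1 ^+ 2).
  apply: (canRL (mulfK _)); first by rewrite subr_eq0 gt_eqF.
  lra.
rewrite mxtrace0 addr0 /mxtrace sum_ord3 !mxE /=; split => //; ring.
Qed.

Lemma steady_two {R : realType} {lambda1 h : R} {T : {set 'I_4}}
    (Y := kfsa_instance lambda1 h) :
  0 < `|lambda1| < 1 -> 0 < h -> two_of_first_three T -> 3 \notin T ->
  [/\ 3 < \tr (steady_prior Y T),
      \tr (steady_prior Y T) <= 3 + h ^+ 2,
      \tr (steady_prior Y T) <= 2 + 1 / (1 - lambda1 ^+ 2),
      1 <= \tr (steady_post Y T) <= 1 + h ^+ 2 &
      \tr (steady_post Y T) <= 1 / (1 - lambda1 ^+ 2)].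
Proof.
move=> hl h0 T2 T3; apply: (@steady_line _ _ _ _ (line_cov13 h)) => //.
- by rewrite mxE.
- by rewrite /mxtrace sum_ord3 !mxE /=; ring.
- by move=> s s0; exact: meas_update_two.
Qed.

Lemma steady_full {R : realType} {lambda1 h : R} {T : {set 'I_4}}
    (Y := kfsa_instance lambda1 h) :
  `|lambda1| < 1 -> 0 < h -> two_of_first_three T -> 3 \in T ->
  \tr (steady_prior Y T) = 3 /\ \tr (steady_post Y T) = 0.
Proof.
move=> hl h0 T2 T3; rewrite -[X in _ /\ _ = X](mxtrace0 R 3).
by apply: steady_const => // [|s s0]; [rewrite mxE | exact: meas_update_full].
Qed.

(** * Optimal and greedy attacks *)

Lemma steady_le {R : realType} {lambda1 h : R} {S : {set 'I_4}}
    (Y := kfsa_instance lambda1 h) :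
  0 < `|lambda1| < 1 -> 0 < h -> (#|S| <= 2)%N ->
  \tr (steady_prior Y (~: S)%SET) <= 2 + 1 / (1 - lambda1 ^+ 2) /\
  \tr (steady_post Y (~: S)%SET) <= 1 / (1 - lambda1 ^+ 2).
Proof.
move=> hl h0; have /andP[hl0 hl1] := hl.
have l1 : lambda1 ^+ 2 < 1 by rewrite -real_normK ?num_real // expr_lt1.
have L1 : 1 <= 1 / (1 - lambda1 ^+ 2).
  by rewrite ler_pdivlMr ?subr_gt0 // mul1r gerBl sqr_ge0.
rewrite -sum1_card big_mkcond sum_ord4 /=.
have [T2 _|T2] := boolP (two_of_first_three (~: S)%SET).
  have [T3|T3] := boolP (3 \in (~: S)%SET).
    have [-> ->] := steady_full hl1 h0 T2 T3; split; lra.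
  by have [] := steady_two hl h0 T2 T3.
(* Here the budget is spent on two of the sensors 0, 1, 2, so the survivors are sensor 3 and one of
   these: {2, 3}, {1, 3} and {0, 3}, in this order. *)
move: T2; rewrite /two_of_first_three !inE.
case S0: (0 \in S); case S1: (1 \in S); case S2: (2 \in S);
  case S3: (3 \in S) => //= _ _.
- by have [-> ->] := @steady_23 R lambda1 h (~: S)%SET hl1
    ltac:(by rewrite inE S0) ltac:(by rewrite inE S1) ltac:(by rewrite inE S2)
    ltac:(by rewrite inE S3).
- have [||-> ->] := @steady_const R lambda1 h (~: S)%SET (delta_mx 1 1) hl1.
  + by rewrite mxE.
  + by move=> s s0; apply: meas_update_13; rewrite // inE ?S0 ?S1 ?S2 ?S3.
  + rewrite /mxtrace sum_ord3 !mxE /=; split; lra.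
- have [|||_ _ ? _ ?] :=
    @steady_line R lambda1 h (~: S)%SET (line_cov12 h) hl h0 => //.
  + by rewrite mxE.
  + by rewrite /mxtrace sum_ord3 !mxE /=; ring.
  + by move=> s s0; apply: meas_update_03; rewrite // inE ?S0 ?S1 ?S2 ?S3.
Qed.

(** The attack on sensors 0 and 1 attains the bound of [steady_le], which fixes the optimal value
    without identifying the optimal set. *)
Lemma steady_optimal {R : realType} {lambda1 h : R} {S : {set 'I_4}}
    (Y := kfsa_instance lambda1 h) :
  0 < `|lambda1| < 1 -> 0 < h ->
  (optimal_attack (fun T => \tr (steady_prior Y T)) 2 S ->
   \tr (steady_prior Y (~: S)%SET) = 2 + 1 / (1 - lambda1 ^+ 2)) /\
  (optimal_attack (fun T => \tr (steady_post Y T)) 2 S ->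
   \tr (steady_post Y (~: S)%SET) = 1 / (1 - lambda1 ^+ 2)).
Proof.
move=> hl h0; have /andP[_ hl1] := hl.
have c2 : (#|[set 0%R; 1%R : 'I_4]%SET| <= 2)%N by rewrite cards2.
have [e1 e2] := @steady_23 R lambda1 h (~: [set 0; 1])%SET hl1
    ltac:(by rewrite !inE) ltac:(by rewrite !inE) ltac:(by rewrite !inE)
    ltac:(by rewrite !inE).
split=> -[/(steady_le hl h0)[le1 le2] /(_ _ c2)]; rewrite ?e1 ?e2 => ?;
  by apply/eqP; rewrite eq_le; apply/andP.
Qed.

(* Only the first greedy step matters: once the paper's sensor 4 is gone, every
   second choice leaves two of the first three sensors. *)
Lemma greedy_two {R : realType} (F : {set 'I_4} -> R) (c : R)
    (S : {set 'I_4}) :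
  (forall T, two_of_first_three T -> 3 \notin T -> c < F T) ->
  (forall T, two_of_first_three T -> 3 \in T -> F T <= c) ->
  greedy_attack F 2 S ->
  two_of_first_three (~: S)%SET /\ 3 \notin (~: S)%SET.
Proof.
move=> F_gt F_le g2.
inversion g2 as [|m S1 j2 g1 j2S1 _ em eS]; subst.
inversion g1 as [|m S0 j1 g0 j1S0 mx1 em eS]; subst.
inversion g0; subst => {g0 g1 g2 j1S0}.
(* Any other first choice keeps sensor 3 and two of the first three, so its value is at most [c],
   while removing sensor 3 yields more than [c]. *)
have {mx1} j13 : j1 = 3.
  apply/eqP; apply: contraT => j1N3.
  move: {mx1 j2S1}(mx1 3); rewrite !inE => /(_ isT); rewrite leNgt => /negP[].
  apply: (@le_lt_trans _ _ c); [apply: F_le | apply: F_gt].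
  - by elim/forall_ord4: j1 j1N3; rewrite /two_of_first_three !inE.
  - by rewrite !inE orbF eq_sym.
  - by rewrite /two_of_first_three !inE.
  - by rewrite !inE.
subst j1; move: j2S1; elim/forall_ord4: j2;
  by rewrite /two_of_first_three !inE.
Qed.

(** * Limits of the two ratios *)

Theorem theorem4 (R : realType) (lambda1 : R)
    (hlambda : 0 < `|lambda1| < 1) :
  (forall Sgre Sopt : R -> {set 'I_4},
     (forall h : R, 0 < h ->
        greedy_attack
          (fun T => \tr (steady_prior (kfsa_instance lambda1 h) T))
          2 (Sgre h)) ->
     (forall h : R, 0 < h ->
        optimal_attack
          (fun T => \tr (steady_prior (kfsa_instance lambda1 h) T))
          2 (Sopt h)) ->
     \tr (steady_prior (kfsa_instance lambda1 h) (~: Sopt h)%SET) /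
     \tr (steady_prior (kfsa_instance lambda1 h) (~: Sgre h)%SET)
       @[h --> 0^'+] --> 2 / 3 + 1 / (3 * (1 - lambda1 ^+ 2)))
  /\
  (forall Sgre Sopt : R -> {set 'I_4},
     (forall h : R, 0 < h ->
        greedy_attack
          (fun T => \tr (steady_post (kfsa_instance lambda1 h) T))
          2 (Sgre h)) ->
     (forall h : R, 0 < h ->
        optimal_attack
          (fun T => \tr (steady_post (kfsa_instance lambda1 h) T))
          2 (Sopt h)) ->
     \tr (steady_post (kfsa_instance lambda1 h) (~: Sopt h)%SET) /
     \tr (steady_post (kfsa_instance lambda1 h) (~: Sgre h)%SET)
       @[h --> 0^'+] --> 1 / (1 - lambda1 ^+ 2)).
Proof.
have /andP[_ hl1] := hlambda.
have sq0 : (h ^+ 2 : R) @[h --> 0^'+] --> (0 : R).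
  have -> : nbhs (0 : R) = nbhs ((0 : R) ^+ 2) by rewrite expr0n.
  by apply: cvg_at_right_filter; exact: exprn_continuous.
have l1 : 0 < 1 - lambda1 ^+ 2.
  by rewrite subr_gt0 -real_normK ?num_real // expr_lt1.
have inv_cvg (c K : R) : 0 < c ->
    K / (c + h ^+ 2) @[h --> 0^'+] --> K / c.
  move=> c0; apply: cvgM; first exact: cvg_cst.
  apply: cvgV; first by rewrite gt_eqF.
  have := cvgD (cvg_cst c) sq0; rewrite addr0; exact.
split=> Sgre Sopt gre opt.
- set L := 1 / (1 - lambda1 ^+ 2).
  have -> : 2 / 3 + 1 / (3 * (1 - lambda1 ^+ 2)) = (2 + L) / 3.
    by rewrite /L; field; rewrite gt_eqF.
  (* The numerator is constantly 2 + L, and the greedy trace lies between 3 and 3 + h^2. *)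
  apply: (@squeeze_cvgr _ _ _ _ (fun h => (2 + L) / (3 + h ^+ 2))
    (fun=> (2 + L) / 3)).
  + near=> h.
    have h0 : 0 < h by near: h; exact: nbhs_right_gt.
    rewrite ((steady_optimal hlambda h0).1 (opt h h0)) -/L.
    (* The threshold 3 is the prior trace when the state is fully determined; for the posterior
       trace it is 0. *)
    have [||T2 T3] := @greedy_two R _ 3 _ _ _ (gre h h0).
    * by move=> T T2 T3; have [] := steady_two hlambda h0 T2 T3.
    * by move=> T T2 T3; have [->] := steady_full hl1 h0 T2 T3.
    have [gt3 le3 _ _ _] := steady_two hlambda h0 T2 T3.
    have L0 : 0 <= 2 + L.
      by rewrite addr_ge0 // divr_ge0 // ltW.
    apply/andP; split; rewrite ler_wpM2l // lef_pV2 ?posrE //; lra.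
  + exact: inv_cvg.
  + exact: cvg_cst.
- set L := 1 / (1 - lambda1 ^+ 2).
  apply: (@squeeze_cvgr _ _ _ _ (fun h => L / (1 + h ^+ 2)) (fun=> L)).
  + near=> h.
    have h0 : 0 < h by near: h; exact: nbhs_right_gt.
    rewrite ((steady_optimal hlambda h0).2 (opt h h0)) -/L.
    have [||T2 T3] := @greedy_two R _ 0 _ _ _ (gre h h0).
    * move=> T T2 T3; have [_ _ _ /andP[+ _] _] := steady_two hlambda h0 T2 T3.
      exact: lt_le_trans.
    * by move=> T T2 T3; have [_ ->] := steady_full hl1 h0 T2 T3.
    have [_ _ _ /andP[ge1 le1] _] := steady_two hlambda h0 T2 T3.
    have L0 : 0 <= L.
      by rewrite divr_ge0 // ltW.
    apply/andP; split.
      rewrite ler_wpM2l // lef_pV2 ?posrE //; lra.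
    rewrite ler_piMr // invf_le1 //; lra.
  + by have := inv_cvg 1 L ltr01; rewrite divr1.
  + exact: cvg_cst.
Unshelve. all: by end_near.
Qed.
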